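(* For every sufficiently large integer $r$, $$p_{\mathrm{path}}(r)\ge (1-o(1))\,r\log\log r,$$ where $o(1)$ denotes a function of $r$ tending to $0$ as $r\to\infty$.
   Context: An $r$-edge-coloured complete graph is a finite complete graph $K_n$ each of whose edges is assigned one of $r$ colours (the colouring need not be proper, and not all colours need be used). A monochromatic path is a path all of whose edges have the same colour; a single vertex counts as a (trivial) monochromatic path. For $r\ge 2$, $p_{\mathrm{path}}(r)$ denotes the minimum number of vertex-disjoint monochromatic paths needed to partition the vertex set of any $r$-edge-coloured complete graph, i.e. the smallest integer $p$ such that the vertex set of every $r$-edge-coloured complete graph (of any finite order) can be partitioned into the vertex sets of at most $p$ monochromatic paths. (This number is known to be finite.) Logarithms are natural. *)

(* Defs.v *)
From mathcomp Require Import all_boot all_order all_algebra.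
From mathcomp Require Import all_classical all_reals all_analysis.
Set Implicit Arguments.
Unset Strict Implicit.
Unset Printing Implicit Defensive.
Import Order.TTheory GRing.Theory Num.Theory.
Import numFieldNormedType.Exports.

Local Open Scope classical_set_scope.
Local Open Scope ring_scope.

(* The colour of the edge xy of the complete graph on V is c x y; the values
   c x x on the diagonal carry no meaning and are never inspected below, since
   paths have no repeated vertex. *)
Definition edge_colouring (r : nat) (V : finType) (c : V -> V -> 'I_r) : Prop :=
  forall x y : V, c x y = c y x.

Definition monochromatic_path (r : nat) (V : finType) (c : V -> V -> 'I_r)
    (s : seq V) : Prop :=
  [/\ s <> [::], uniq s & exists i : 'I_r, sorted [rel x y | c x y == i] s].

Definition partitionable_into_paths (r : nat) (V : finType)
    (c : V -> V -> 'I_r) (p : nat) : Prop :=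
  exists P : {set {set V}},
    [/\ finset.partition P [set: V]%SET, (#|P| <= p)%N &
        forall B : {set V}, B \in P ->
          exists2 s : seq V, monochromatic_path c s & B = finset [in s]].

Definition paths_suffice (r p : nat) : Prop :=
  forall (V : finType) (c : V -> V -> 'I_r),
    edge_colouring c -> partitionable_into_paths c p.

(* The infimum is taken in the extended reals so that the definition does not
   presuppose that some p suffices (it would be +oo otherwise). *)
Definition p_path (R : realType) (r : nat) : \bar R :=
  ereal_inf [set (p%:R)%:E | p in [set p : nat | paths_suffice r p]].

Lemma p_path_least (R : realType) (r p : nat) :
  paths_suffice r p -> (forall q, paths_suffice r q -> (p <= q)%N) ->
  p_path R r = (p%:R)%:E.
Proof.
move=> Hp Hmin; apply/eqP; rewrite eq_le; apply/andP; split.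
  by apply: ereal_inf_lbound; exists p.
by apply: le_ereal_inf_tmp => _ [q Hq <-]; rewrite lee_fin ler_nat; apply: Hmin.
Qed.

(* Main.v *)
Require Import Defs.
From mathcomp Require Import all_boot all_order all_algebra.
From mathcomp Require Import all_classical all_reals all_analysis.
From mathcomp Require Import zify ring lra.
Import Order.TTheory GRing.Theory Num.Theory.
Import numFieldNormedType.Exports.
Set Implicit Arguments.
Unset Strict Implicit.
Unset Printing Implicit Defensive.

(** Fix a small delta and write l = ln (ln r). The colouring that forces
    (1 - 5 delta) r l paths is built from K layers of vertices, layer k being
    beta times as large as layer k-1, with K a little smaller than ln r. Each
    layer k owns s colours, where K s is about (1 - delta) r, and the remaining
    m, about delta r, colours are used inside all the layers simultaneously.

    Every vertex y carries a label lab y in [a], and every vertex x an injection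
    pi x from [a] to [s]. An edge from x in layer k to y in a higher layer has
    the colour number pi x (lab y) among those owned by k. As pi x is injective,
    the labels of the higher vertices of a monochromatic path all agree, so such
    a path is described by one pair (c, b): it can only pick up vertices x of
    layer k with pi x b = c, and pays for each of them with a higher vertex of
    label b. All injections occur equally often in layer k, and this makes the
    pairs behave like independent events:
    - if the Q paths in the colours of layer k use d b pairs with label b, the
      proportion of x avoiding all of them is about the product of the
      1 - d b / s, that is exp (- Q / s);
    - the labels b for which d b is not small compared with s are few, about
      l / delta out of the a labels, so that all vertices carrying them together
      are too few to matter, even though the higher layers are far larger than
      layer k.
    Hence with Q < (1 - 3 delta) s l a proportion of about (ln r)^(delta - 1) of
    layer k is missed. The lower layers are too small to make up for it. The
    colours used inside the layers could, since they are shared; but an edge of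
    inner colour i touches the i-th of m equal pieces of its layer, so each such
    path covers at most 2/m of the layer, and covering the missed proportion
    takes about delta r (ln r)^(delta - 1) of these paths, more than s l because
    s is about r / K. Thus each layer separately accounts for at least
    (1 - 3 delta) s l paths, and K s l is about r l.

    The double logarithm comes from the competition between exp (- Q / s) and K:
    if Q is about L s, the inner paths are expensive enough only if K exceeds
    exp L, while the ratio beta ^ K between the sizes of the layers has to stay
    below the number a of labels and a ^ 2 below s, which bounds K by about ln r.

    The combinatorial half ends with [layered_inequality]; [layer_cost_ge] turns
    it into the lower bound for one layer, and [layered_parameters] supplies the
    integers. *)

(** * Counting *)

(** Each A-vertex but the last can be charged to its successor on the path, which
    lies in Z. *)
Lemma count_path_le (T : eqType) (e : rel T) (A Z : pred T) (s : seq T) :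
    (forall x y, x \in s -> y \in s -> e x y -> (A x -> Z y) /\ (A y -> Z x)) ->
  sorted e s -> (count A s <= (count Z s).+1)%N.
Proof.
(* The extra 1 is needed only when the path does not start in Z; this sharper form
   is what the induction carries. *)
case: s => [|x s] //= nbr es.
suff: (A x + count A s <= Z x + count Z s + ~~ Z x)%N by case: (Z x) => /=; lia.
elim: s x nbr es => [|y s IHs] x nbr /=.
  by move=> _; case: (A x) => //; case: (Z x).
move=> /andP[exy eys].
have ys : y \in [:: x, y & s] by rewrite !inE eqxx orbT.
have [AZ ZA] := nbr x y (mem_head _ _) ys exy.
have /IHs : forall u v, u \in y :: s -> v \in y :: s -> e u v ->
    (A u -> Z v) /\ (A v -> Z u).
  by move=> u v us vs; apply: nbr; rewrite inE ?us ?vs orbT.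
move=> /(_ eys).
case: (A x) AZ => [/(_ isT)->|_] /=; lia.
Qed.

Lemma card_partition_cap (T : finType) (P : {set {set T}}) (A : {set T}) :
  finset.partition P [set: T] -> \sum_(B in P) #|A :&: B| = #|A|.
Proof.
move=> partP.
rewrite -sum1_card (eq_bigl (fun x => (x \in [set: T]) && (x \in A))); last first.
  by move=> x; rewrite inE.
rewrite (set_partition_big_cond _ partP) /=.
apply: eq_bigr => B _; rewrite -sum1_card; apply: eq_bigl => x.
by rewrite inE andbC.
Qed.

Lemma card_val (U : finType) (P Q : pred U) :
  #|[set v : {x | P x} | Q (val v)]| = #|[set x | P x && Q x]|.
Proof.
rewrite -(card_imset _ val_inj); congr #|pred_of_set _|; apply/setP => x.
rewrite inE; apply/imsetP/andP => [[v]|[Px Qx]].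
  by rewrite inE => Qv ->; split=> //; exact: (valP v).
by exists (exist _ x Px); rewrite ?inE.
Qed.

(** Choosing the values one at a time, at each step at most a + #|D b| of the s
    values are excluded. The induction runs over j, the number of values already
    constrained, with the other values left free, so as not to change the type
    of the functions. *)
Lemma card_inj_avoid (a s : nat) (D : 'I_a -> {set 'I_s}) :
  (\prod_(b < a) (s - a - #|D b|) <=
     #|[set f : {ffun 'I_a -> 'I_s} | injectiveb f && [forall b, f b \notin D b]]|)%N.
Proof.
pose S j := [set f : {ffun 'I_a -> 'I_s} |
  [forall b : 'I_a, (b < j) ==> (f b \notin D b)] &&
  [forall b : 'I_a, forall c : 'I_a, (b < c) && (c < j) ==> (f b != f c)]].
have step (j : 'I_a) : (#|S j| * (s - a - #|D j|) <= #|S j.+1| * s)%N.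
  (* Overwriting f j by a good v extends a function of S j to one of S j.+1; keeping
     the old value f j as well makes this injective. *)
  pose good (f : {ffun 'I_a -> 'I_s}) := ~: (D j :|: [set f b | b in 'I_a]).
  pose put (f : {ffun 'I_a -> 'I_s}) v := [ffun b => if b == j then v else f b].
  pose W := [set fv : {ffun 'I_a -> 'I_s} * 'I_s | (fv.1 \in S j) && (fv.2 \in good fv.1)].
  apply: (@leq_trans #|W|).
    rewrite -sum_nat_const; apply: (@leq_trans (\sum_(f in S j) #|good f|)).
      apply: leq_sum => f _; rewrite /good.
      have := cardsC (D j :|: [set f b | b in 'I_a]); rewrite card_ord.
      have := cardsU (D j) [set f b | b in 'I_a].
      have : (#|[set f b | b in 'I_a]| <= a)%N.
        by rewrite (leq_trans (leq_imset_card _ _)) // card_ord.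
      by move: #|_ @: _| #|_ :|: _| #|_ :&: _| #|~: _| #|D j|; lia.
    rewrite leq_eqVlt; apply/orP; left; apply/eqP.
    under eq_bigr do rewrite -sum1_card.
    rewrite pair_big_dep /= -sum1_card; apply: eq_bigl => -[f v].
    by rewrite [in RHS]inE.
  apply: (@leq_trans #|finset.setX (S j.+1) [set: 'I_s]|); last first.
    by rewrite cardsX cardsT card_ord.
  pose h (fv : {ffun 'I_a -> 'I_s} * 'I_s) := (put fv.1 fv.2, fv.1 j).
  have h_inj : injective h.
    move=> [f v] [f' v'] [/ffunP eqf eqj].
    have := eqf j; rewrite !ffunE eqxx => ->; congr pair; apply/ffunP => b.
    by have := eqf b; rewrite !ffunE; case: eqP => [->|].
  rewrite -(card_imset _ h_inj); apply/subset_leq_card/fintype.subsetP => _ /imsetP[[f v] + ->].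
  rewrite !inE /= => /andP[/andP[/forallP fD /forallP fI]].
  rewrite negb_or => /andP[vD vf]; rewrite andbT; apply/andP; split.
    apply/forallP => b; apply/implyP => ltb; rewrite ffunE.
    case: eqP => [->//|/eqP nbj]; apply: (implyP (fD b)).
    by move: nbj; rewrite -val_eqE /=; lia.
  apply/forallP => b; apply/forallP => c; apply/implyP => /andP[bc cj].
  rewrite !ffunE; have -> : (b == j) = false by apply/negbTE; rewrite -val_eqE /=; lia.
  case: (c =P j) => [_|/eqP ncj].
    by apply: contraNneq vf => <-; apply: imset_f.
  apply: (implyP (forallP (fI b) c)); rewrite bc /=.
  by move: ncj; rewrite -val_eqE /=; lia.
have main j : (j <= a)%N ->
    ((\prod_(b < a | (b < j)%N) (s - a - #|D b|)) * s ^ (a - j) <= #|S j|)%N.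
  elim: j => [_|j IHj ltja].
    rewrite big_pred0 // subn0 mul1n.
    have -> : S 0 = [set: {ffun 'I_a -> 'I_s}].
      apply/setP => f; rewrite !inE; apply/andP; split; apply/forallP => b //.
      by apply/forallP => c; rewrite ltn0 andbF.
    by rewrite cardsT card_ffun !card_ord.
  have [s0|s_gt0] := posnP s; last first.
    rewrite -(leq_pmul2r s_gt0); apply: leq_trans (step (Ordinal ltja)).
    rewrite (bigD1 (Ordinal ltja)) //= -mulnA -expnSr -subSn // subSS.
    rewrite (eq_bigl (fun b : 'I_a => (b < j)%N)) => [|b]; last first.
      by rewrite -val_eqE /=; lia.
    rewrite -mulnA mulnC leq_mul2r; apply/orP; right.
    exact: IHj (ltnW ltja).
  rewrite (bigD1 (Ordinal ltja)) //=.
  by have -> : (s - a - #|D (Ordinal ltja)| = 0)%N by lia.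
have := main a (leqnn a); rewrite subnn expn0 muln1.
rewrite (eq_bigl xpredT) => [|b]; last exact: ltn_ord.
move=> /leq_trans; apply; apply/subset_leq_card/fintype.subsetP => f.
rewrite !inE => /andP[/forallP fD /forallP fI]; apply/andP; split.
  apply/injectiveP => b c eqf; apply/val_inj/eqP; apply: contraT => nbc.
  have [bc|cb|/eqP] := ltngtP b c; last by rewrite (negbTE nbc).
    by have := implyP (forallP (fI b) c); rewrite bc ltn_ord eqf eqxx => /(_ isT).
  by have := implyP (forallP (fI c) b); rewrite cb ltn_ord eqf eqxx => /(_ isT).
by apply/forallP => b; apply: (implyP (fD b)).
Qed.

(** * The layered colouring *)

Section LayeredColouring.
Variables (K s a m : nat) (V : finType).
Variables (lay : V -> 'I_K) (lab : V -> 'I_a).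
Variables (pi : V -> 'I_a -> 'I_s) (inn : V -> 'I_m).
Hypothesis pi_inj : forall v, injective (pi v).

(** On an edge inside a layer the colour is the smaller of the two inner indices:
    any symmetric rule choosing one of them would do, since all that matters is
    that an edge of colour inr i has an end of inner index i. *)
Definition layered_colour (x y : V) : 'I_K * 'I_s + 'I_m :=
  if (lay x < lay y)%N then inl (lay x, pi x (lab y))
  else if (lay y < lay x)%N then inl (lay y, pi y (lab x))
  else inr (if (inn x <= inn y)%N then inn x else inn y).

Lemma layered_colourC x y : layered_colour x y = layered_colour y x.
Proof.
rewrite /layered_colour; case: ltngtP => // _.
by case: ltngtP => // eqi; congr inr; apply: val_inj.
Qed.

Lemma layered_colour_inl x y j c : layered_colour x y = inl (j, c) ->
  (lay x = j /\ (j < lay y)%N /\ pi x (lab y) = c) \/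
  (lay y = j /\ (j < lay x)%N /\ pi y (lab x) = c).
Proof.
rewrite /layered_colour; case: ltngtP => // lxy [<- <-]; first by left.
by right.
Qed.

Lemma layered_colour_inr x y i : layered_colour x y = inr i ->
  lay x = lay y /\ (inn x = i \/ inn y = i).
Proof.
rewrite /layered_colour; case: ltngtP => // /val_inj-> [<-]; split=> //.
by case: leqP => _; [left|right].
Qed.

Variables (P : {set {set V}}) (gam : {set V} -> 'I_K * 'I_s + 'I_m).
Hypothesis partP : finset.partition P [set: V].
Hypothesis monoP : forall B, B \in P ->
  exists2 q : seq V, [/\ q <> [::], uniq q &
    sorted [rel x y | layered_colour x y == gam B] q] & B = finset [in q].

Definition cross_blocks (k : 'I_K) : {set {set V}} :=
  [set B in P | if gam B is inl (j, _) then j == k else false].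

(** A path of inner colour stays in one layer, whence the sets of inner blocks of
    different layers are disjoint although they share their colours. *)
Definition inner_blocks (k : 'I_K) : {set {set V}} :=
  [set B in P | if gam B is inr _ then [exists v in B, lay v == k] else false].

Lemma block_cap_le (B A Z : {set V}) : B \in P ->
    (forall x y, x \in B -> y \in B -> layered_colour x y = gam B ->
       x \in A -> y \in Z) ->
  (#|A :&: B| <= #|Z :&: B|.+1)%N.
Proof.
move=> BP AZ; have [q [_ uq sq] defB] := monoP BP.
have cnt (X : {set V}) : #|X :&: B| = count (mem X) q.
  rewrite -size_filter -(card_uniqP (filter_uniq _ uq)).
  by apply: eq_card => v; rewrite defB !inE mem_filter.
rewrite !cnt; apply: count_path_le sq => x y xq yq /= /eqP exy.
have xB : x \in B by rewrite defB inE.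
have yB : y \in B by rewrite defB inE.
by split; [exact: AZ|apply: AZ => //; rewrite layered_colourC].
Qed.

Lemma block_const (T : eqType) (h : V -> T) B : B \in P ->
    (forall x y, layered_colour x y = gam B -> h x = h y) ->
  {in B &, forall x y, h x = h y}.
Proof.
move=> BP hC; have [q [_ _ sq] ->] := monoP BP.
case: q sq => [_ x y|z q /= pq]; first by rewrite inE.
suff hz x : x \in z :: q -> h x = h z.
  by move=> x y; rewrite !inE => xq yq; rewrite !hz.
elim: q z pq x => [|y q IHq] z /=; first by move=> _ x; rewrite inE => /eqP->.
move=> /andP[/eqP/hC zy /IHq hy] x; rewrite inE => /orP[/eqP->//|/hy->].
by rewrite zy.
Qed.

(** The layers are charged for disjoint sets of blocks, which is what makes the
    costs of the layers add up. *)
Lemma sum_blocks_le :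
  (\sum_(k < K) (#|cross_blocks k| + #|inner_blocks k|) <= #|P|)%N.
Proof.
under eq_bigr do rewrite -!sum1_card.
rewrite -[leqRHS]sum1_card.
under eq_bigr => k _.
  rewrite (eq_bigl (fun B => (B \in P) && (B \in cross_blocks k))); last first.
    by move=> B; rewrite !inE andbA andbb.
  rewrite [X in (_ + X)%N]
    (eq_bigl (fun B => (B \in P) && (B \in inner_blocks k))); last first.
    by move=> B; rewrite !inE andbA andbb.
  rewrite !big_mkcondr -big_split /=.
  over.
rewrite exchange_big; apply: leq_sum => B BP /=.
under eq_bigr do rewrite !inE BP /=.
case defg: (gam B) => [[j c]|i].
  rewrite (bigD1 j) //= eqxx big1 // => k kj.
  by rewrite eq_sym (negbTE kj).
have lay_const : {in B &, forall x y, lay x = lay y}.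
  by apply: block_const => // x y; rewrite defg => /layered_colour_inr[].
have [v vB] : exists v, v \in B.
  by apply/set0Pn; apply: contraTneq BP => ->; case/and3P: partP.
rewrite (bigD1 (lay v)) //= big1 ?addn0; first by case: ifP.
move=> k kv; case: ifP => // /existsP[w /andP[wB /eqP eqw]].
by move: kv; rewrite -eqw (lay_const w v) ?eqxx.
Qed.

(** The label attached to the component of v in the colour inl (k, c): for v above
    layer k its own label, and for v in layer k the label towards which v uses c. *)
Definition label_on (k : 'I_K) (c : 'I_s) (v : V) : option 'I_a :=
  if lay v == k then [pick b | pi v b == c] else Some (lab v).

(** This is where the injectivity of pi keeps the components small. *)
Lemma label_on_const (k : 'I_K) c x y : layered_colour x y = inl (k, c) ->
  label_on k c x = label_on k c y.
Proof.
have pick_pi v b : pi v b = c -> [pick b' | pi v b' == c] = Some b.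
  case: pickP => [b' /eqP <- /pi_inj->//|/(_ b) + eqc].
  by rewrite eqc eqxx.
move=> /layered_colour_inl[] [lk [kl pc]]; rewrite /label_on lk eqxx (pick_pi _ _ pc).
  by case: eqP kl => // ->; rewrite ltnn.
by case: eqP kl => // ->; rewrite ltnn.
Qed.

(** The c for which some path of the partition has the pair (c, b). *)
Definition forbidden (k : 'I_K) (b : 'I_a) : {set 'I_s} :=
  [set c | [exists B in P, (gam B == inl (k, c)) &&
                           [exists v in B, label_on k c v == Some b]]].

(** Each cross path accounts for a single pair (c, b). *)
Lemma sum_forbidden_le (k : 'I_K) :
  (\sum_(b < a) #|forbidden k b| <= #|cross_blocks k|)%N.
Proof.
pose W := [set bc : 'I_a * 'I_s | bc.2 \in forbidden k bc.1].
have -> : (\sum_(b < a) #|forbidden k b| = #|W|)%N.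
  under eq_bigr do rewrite -sum1_card.
  rewrite pair_big_dep /= -sum1_card; apply: eq_bigl => -[b c].
  by rewrite [in RHS]inE.
pose colb B := if gam B is inl (_, c) then Some c else None.
pose labb B := if (colb B, [pick v in B]) is (Some c, Some v) then label_on k c v else None.
pose h B := (labb B, colb B).
have Some2_inj : injective (fun bc : 'I_a * 'I_s => (Some bc.1, Some bc.2)).
  by move=> [b c] [b' c'] [-> ->].
rewrite -(card_imset _ Some2_inj); apply: leq_trans (leq_imset_card h _).
apply/subset_leq_card/fintype.subsetP => _ /imsetP[[b c] + ->].
rewrite !inE /= => /existsP[B /andP[BP /andP[/eqP defg /existsP[v /andP[vB /eqP lv]]]]].
apply/imsetP; exists B; first by rewrite inE BP defg eqxx.
rewrite /h /labb /colb defg; case: pickP => [w wB|/(_ v)]; last by rewrite vB.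
congr (_, _); rewrite -lv; apply: block_const BP _ _ _ vB wB => x y.
by rewrite defg; exact: label_on_const.
Qed.

(** H is a set of labels that are given up, to be taken as those with many
    forbidden colours. The vertices of layer k that avoid the forbidden colours of
    all other labels are covered
    - by cross paths of layer k, at the price of vertices with label in H;
    - by paths in the colours of a lower layer, at the price of vertices there;
    - by paths of inner colour i, at the price of the vertices of layer k with
      inner index i;
    the term #|P| accounts for the ends of the paths. *)
Lemma layer_card_le (k : 'I_K) (H : {set 'I_a}) (I : nat) :
    (forall i, #|[set v | (lay v == k) && (inn v == i)]| <= I)%N ->
  (#|[set x | (lay x == k) && [forall b in ~: H, pi x b \notin forbidden k b]]| <=
     #|inner_blocks k| * (2 * I) + #|[set y | lab y \in H]|
     + #|[set y | (lay y < k)%N]| + #|P|)%N.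
Proof.
move=> leI; set T := [set x | _]; set Y := [set y | lab y \in H].
set X := [set y | (_ < _)%N].
rewrite -(card_partition_cap T partP) -(card_partition_cap Y partP).
rewrite -(card_partition_cap X partP).
have -> : (#|inner_blocks k| * (2 * I) =
    \sum_(B in P) if B \in inner_blocks k then 2 * I else 0)%N.
  rewrite -big_mkcondr -sum_nat_const /=; apply: eq_bigl => B.
  by rewrite !inE andbA andbb.
rewrite -sum1_card -!big_split /=; apply: leq_sum => B BP.
case defg: (gam B) => [[j c]|i].
  have [jk|jk] := eqVneq j k.
    (* If the label of y were outside H, then x in T would not use at this label
       the colour of B, which B itself makes forbidden there. *)
    suff : (#|T :&: B| <= #|Y :&: B|.+1)%N by lia.
    apply: block_cap_le => // x y xB yB; rewrite defg jk => cxy.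
    rewrite !inE => /andP[/eqP lx /forallP xD].
    have [[_ [ky pxc]]|[ly [+ _]]] := layered_colour_inl cxy; last by rewrite lx ltnn.
    apply: contraT => yH; have := xD (lab y); rewrite inE yH pxc /= inE.
    case/existsP; exists B; rewrite BP defg jk eqxx /=; apply/existsP; exists y.
    rewrite yB /label_on; case: (lay y =P k) => [eqk|_]; last by rewrite eqxx.
    by move: ky; rewrite eqk ltnn.
  suff : (#|T :&: B| <= #|X :&: B|.+1)%N by lia.
  apply: block_cap_le => // x y xB yB; rewrite defg => cxy.
  rewrite !inE => /andP[/eqP lx _].
  have [[lj _]|[<- []]] := layered_colour_inl cxy; last by rewrite lx.
  by move: jk; rewrite -lj lx eqxx.
case: (boolP (B \in inner_blocks k)) => [_|]; last first.
  rewrite inE BP defg negb_exists /= => /forallP nk.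
  suff -> : T :&: B = finset.set0 by rewrite cards0.
  apply/setP => x; rewrite !inE; apply/negbTE; have := nk x.
  by case: (x \in B); rewrite ?andbF //= => /negbTE->.
(* The vertices of inner index i are counted directly, the others are each next
   to one of them. *)
pose Z := [set v | (lay v == k) && (inn v == i)].
have TZ : (#|T :&: B| <= #|Z| + #|(T :\: Z) :&: B|)%N.
  have /subset_leq_card : T :&: B \subset Z :|: (T :\: Z) :&: B.
    by apply/fintype.subsetP => x; rewrite !inE; case: (_ && (inn x == i)).
  by move/leq_trans; apply; rewrite cardsU leq_subr.
have : (#|(T :\: Z) :&: B| <= #|Z :&: B|.+1)%N.
  apply: block_cap_le => // x y xB yB; rewrite defg => /layered_colour_inr[lxy ixy].
  rewrite !inE => /andP[+ /andP[lx _]]; rewrite -lxy lx /=.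
  by case: ixy => ->; rewrite eqxx.
have : (#|Z :&: B| <= #|Z|)%N by apply: subset_leq_card; apply: subsetIl.
have := leI i; rewrite -/Z. lia.
Qed.

End LayeredColouring.

(** * The layered graph *)

(** The colours may be taken in any type with at most r elements. On a path with
    one vertex the prescribed colour need not come from this type, and is replaced
    by c0. *)
Lemma paths_suffice_fintype (C V : finType) (r p : nat) (col : V -> V -> C) :
    (#|C| <= r)%N -> C -> (forall x y, col x y = col y x) -> paths_suffice r p ->
  exists (P : {set {set V}}) (gam : {set V} -> C),
    [/\ finset.partition P [set: V], (#|P| <= p)%N &
      forall B, B \in P -> exists2 q : seq V,
        [/\ q <> [::], uniq q & sorted [rel x y | col x y == gam B] q] &
        B = finset [in q]].
Proof.
move=> leCr c0 colC /(_ V (fun x y => widen_ord leCr (enum_rank (col x y)))).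
have emb_inj : injective (fun c : C => widen_ord leCr (enum_rank c)).
  by move=> c c' /(congr1 val) /= /ord_inj/enum_rank_inj.
case=> [x y|P [partP leP monoP]]; first by rewrite colC.
have /choice[gam gamP] : forall B : {set V}, exists g : C, B \in P ->
    exists2 q : seq V,
      [/\ q <> [::], uniq q & sorted [rel x y | col x y == g] q] &
      B = finset [in q].
  move=> B; have [BP|_] := boolP (B \in P); last by exists c0.
  have [[|x [|y q]] [// _ uq [i sq]] ->] := monoP B BP.
    by exists c0 => _; exists [:: x].
  exists (col x y) => _; exists [:: x, y & q] => //; split=> //.
  move: sq => /= /andP[/eqP eqi sq]; rewrite eqxx /=.
  apply: sub_path sq => u v /=; rewrite -eqi => /eqP/emb_inj->.
  exact: eqxx.
by exists P, gam.
Qed.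

Section LayeredGraph.
Variables (K s a m N beta : nat).

Notation copies := (N * beta ^ K)%N.
Notation vertex_label :=
  ('I_K * ('I_copies * ('I_a * ({ffun 'I_a -> 'I_s} * 'I_m))))%type.
(** Layer k consists of N * beta ^ k copies of the set of all triples of a label,
    an injection and an inner index. *)
Definition vertex_ok (v : vertex_label) : bool :=
  (v.2.1 < N * beta ^ v.1)%N && injectiveb v.2.2.2.1.
Definition vertex : finType := {v : vertex_label | vertex_ok v}.

Definition v_lay (v : vertex) : 'I_K := (val v).1.
Definition v_lab (v : vertex) : 'I_a := (val v).2.2.1.
Definition v_pi (v : vertex) : 'I_a -> 'I_s := (val v).2.2.2.1.
Definition v_inn (v : vertex) : 'I_m := (val v).2.2.2.2.

Lemma v_pi_inj v : injective (v_pi v).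
Proof. by apply/injectiveP; case/andP: (valP v). Qed.

Lemma card_copies_lt n : (n <= copies)%N -> #|[set i : 'I_copies | (i < n)%N]| = n.
Proof.
move=> le_n; have wid_inj : injective (widen_ord le_n) by move=> i j /(congr1 val) /= /val_inj.
rewrite -[RHS]card_ord -(card_imset predT wid_inj); apply: eq_card => i.
rewrite inE; apply/idP/imsetP => [lti|[j _ ->]]; last exact: (ltn_ord j).
by exists (Ordinal lti) => //; apply: val_inj.
Qed.

Definition injections : {set {ffun 'I_a -> 'I_s}} := [set f : {ffun 'I_a -> 'I_s} | injectiveb f].

Lemma card_injections_le : (#|injections| <= s ^ a)%N.
Proof. by rewrite (leq_trans (max_card _)) // card_ffun !card_ord. Qed.

Definition box (L : {set 'I_K}) (n : nat) (A : {set 'I_a})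
    (F : {set {ffun 'I_a -> 'I_s}}) (M : {set 'I_m}) : {set vertex_label} :=
  finset.setX L (finset.setX [set i : 'I_copies | (i < n)%N]
    (finset.setX A (finset.setX F M))).

Lemma card_box L n A F M : (n <= copies)%N ->
  #|box L n A F M| = (#|L| * (n * (#|A| * (#|F| * #|M|))))%N.
Proof. by move=> len; rewrite !cardsX card_copies_lt. Qed.

Hypothesis beta_gt0 : (0 < beta)%N.

Lemma copies_le (k : nat) : (k <= K)%N -> (N * beta ^ k <= copies)%N.
Proof. by move=> lek; rewrite leq_mul2l leq_pexp2l ?orbT. Qed.

Lemma card_layer_inn (k : 'I_K) (i : 'I_m) :
  (#|[set v | (v_lay v == k) && (v_inn v == i)]| <= N * beta ^ k * (a * s ^ a))%N.
Proof.
rewrite (card_val vertex_ok (fun v => (v.1 == k) && (v.2.2.2.2 == i))).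
apply: (@leq_trans (1 * (N * beta ^ k * (a * (#|injections| * 1))))).
  have := @card_box [set k] _ [set: 'I_a] injections [set i] (copies_le (ltnW (ltn_ord k))).
  rewrite !cards1 cardsT card_ord => <-; apply/subset_leq_card/fintype.subsetP => -[l [j [b [f i']]]].
  by rewrite !inE /= => /andP[/andP[/= jl ->] /andP[/eqP<- ->]]; rewrite eqxx jl.
by rewrite mul1n muln1 !leq_mul // card_injections_le.
Qed.

Lemma card_lab_in (H : {set 'I_a}) :
  (#|[set v | v_lab v \in H]| <= K * (copies * (#|H| * (s ^ a * m))))%N.
Proof.
rewrite (card_val vertex_ok (fun v => v.2.2.1 \in H)).
apply: (@leq_trans (K * (copies * (#|H| * (#|injections| * m))))); last first.
  by rewrite !leq_mul // card_injections_le.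
have := @card_box [set: 'I_K] _ H injections [set: 'I_m] (leqnn _).
rewrite !cardsT !card_ord => <-.
apply/subset_leq_card/fintype.subsetP => -[l [j [b [f i]]]].
by rewrite !inE /= => /andP[/andP[_ ->] ->]; rewrite ltn_ord.
Qed.

Lemma card_lower_layers (k : 'I_K) :
  (beta * #|[set v | (v_lay v < k)%N]| <= K * (N * beta ^ k * (a * (s ^ a * m))))%N.
Proof.
rewrite (card_val vertex_ok (fun v => (v.1 < k)%N)).
case: k => -[|k] ltk /=.
  rewrite (_ : [set _ | _] = finset.set0) ?cards0 ?muln0 //.
  by apply/setP => v; rewrite !inE andbF.
apply: (@leq_trans (beta * (K * (N * beta ^ k * (a * (#|injections| * m)))))).
  rewrite leq_mul2l; apply/orP; right.
  have := @card_box [set: 'I_K] _ [set: 'I_a] injections [set: 'I_m]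
    (copies_le (ltnW (ltnW ltk))).
  rewrite !cardsT !card_ord => <-.
apply/subset_leq_card/fintype.subsetP => -[l [j [b [f i]]]].
  rewrite !inE /= => /andP[/andP[/= jl ->] lk]; rewrite !andbT.
  apply: leq_trans jl _; rewrite leq_mul2l leq_pexp2l ?orbT //.
rewrite mulnCA leq_mul2l; apply/orP; right.
rewrite expnS mulnA [(beta * (N * _))%N]mulnCA leq_mul //.
by rewrite !leq_mul // card_injections_le.
Qed.

Lemma card_layer_avoid (k : 'I_K) (D : 'I_a -> {set 'I_s}) :
  (N * beta ^ k * (a * (\prod_(b < a) (s - a - #|D b|) * m)) <=
    #|[set v | (v_lay v == k) && [forall b, v_pi v b \notin D b]]|)%N.
Proof.
rewrite (card_val vertex_ok (fun v => (v.1 == k) && [forall b, v.2.2.2.1 b \notin D b])).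
pose F : {set {ffun 'I_a -> 'I_s}} :=
  [set f : {ffun 'I_a -> 'I_s} | injectiveb f && [forall b, f b \notin D b]].
have leF : (\prod_(b < a) (s - a - #|D b|) <= #|F|)%N := card_inj_avoid D.
apply: (@leq_trans (1 * (N * beta ^ k * (a * (#|F| * m))))).
  by rewrite mul1n !leq_mul.
have := @card_box [set k] _ [set: 'I_a] F [set: 'I_m] (copies_le (ltnW (ltn_ord k))).
rewrite cards1 !cardsT !card_ord => <-.
apply/subset_leq_card/fintype.subsetP => -[l [j [b [f i]]]].
by rewrite !inE /vertex_ok /= => /and4P[/eqP-> -> /andP[-> ->] _]; rewrite eqxx.
Qed.

(** For layer k, Q k and q k count the cross and the inner paths; d b is the number
    of forbidden colours of b, replaced by 0 for the h labels having more than g of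
    them; x is the size of the lower layers. The last inequality compares the
    vertices of layer k that avoid these colours with all that can cover them. *)
Lemma layered_inequality (r p g : nat) : (0 < m)%N -> (K * s + m <= r)%N ->
    paths_suffice r p ->
  exists (Q q : 'I_K -> nat), (\sum_(k < K) (Q k + q k) <= p)%N /\
    forall k, exists (d : 'I_a -> nat) (h x : nat),
    [/\ (forall b, d b <= g)%N, (\sum_(b < a) d b <= Q k)%N, (h * g <= Q k)%N,
        (beta * x <= K * (N * beta ^ k * (a * (s ^ a * m))))%N &
        (N * beta ^ k * (a * (\prod_(b < a) (s - a - d b) * m)) <=
         q k * (2 * (N * beta ^ k * (a * s ^ a))) +
         K * (copies * (h * (s ^ a * m))) + x + p)%N].
Proof.
move=> m_gt0 ler suff_p.
pose C : finType := ('I_K * 'I_s + 'I_m)%type.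
have leC : (#|C| <= r)%N by rewrite card_sum card_prod !card_ord.
have c0 : C := inr (Ordinal m_gt0).
have [P [gam [partP leP monoP]]] := paths_suffice_fintype leC c0
  (layered_colourC v_lay v_lab v_pi v_inn) suff_p.
exists (fun k => #|cross_blocks P gam k|), (fun k => #|inner_blocks v_lay P gam k|).
split; first by rewrite (leq_trans _ leP) // (sum_blocks_le partP monoP).
move=> k; pose D b := forbidden v_lay v_lab v_pi P gam k b.
have sumD : (\sum_(b < a) #|D b| <= #|cross_blocks P gam k|)%N.
  exact: (sum_forbidden_le v_pi_inj monoP).
pose H : {set 'I_a} := [set b | (g < #|D b|)%N].
exists (fun b => if b \in H then 0 else #|D b|)%N, #|H|, #|[set v : vertex | (v_lay v < k)%N]|.
split.
- by move=> b; rewrite inE; case: (leqP #|D b| g).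
- by apply: leq_trans sumD; apply: leq_sum => b _; case: ifP.
- apply: leq_trans sumD; rewrite -sum_nat_const [leqRHS](bigID (mem H)) /=.
  apply: leq_trans (leq_addr _ _); apply: leq_sum => b; rewrite inE; exact: ltnW.
- exact: card_lower_layers.
have := layer_card_le partP monoP H (card_layer_inn k).
set T := [set x | _] => leT.
apply: leq_trans (_ : (#|T| <= _)%N); last first.
  apply: leq_trans leT _; rewrite !leq_add // card_lab_in //.
apply: leq_trans (_ : (#|[set v | (v_lay v == k) &&
   [forall b, v_pi v b \notin (if b \in H then finset.set0 else D b)]]| <= _)%N).
  apply: leq_trans (card_layer_avoid _ _); rewrite !leq_mul // leq_prod // => b _.
  by case: ifP; rewrite ?cards0.
apply/subset_leq_card/fintype.subsetP => v; rewrite !inE => /andP[-> /forallP vD] /=.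
apply/forallP => b; apply/implyP => bH; have := vD b.
by move: bH; rewrite inE => /negbTE->.
Qed.

End LayeredGraph.

Local Open Scope ring_scope.

(** * The cost of a layer *)

(** [layered_inequality] divided by N * beta ^ k * a * m * s ^ a, an upper bound for
    the size of the layer. The choice of N makes the number p of paths negligible. *)
Lemma layer_density_le (R : realType) (K k s a m N beta p h x q : nat) (d : 'I_a -> nat) :
    (0 < s)%N -> (0 < a)%N -> (0 < m)%N -> (0 < beta)%N -> (0 < N)%N -> (p * beta <= N)%N ->
    (beta * x <= K * (N * beta ^ k * (a * (s ^ a * m))))%N ->
    (N * beta ^ k * (a * (\prod_(b < a) (s - a - d b) * m)) <=
      q * (2 * (N * beta ^ k * (a * s ^ a))) + K * (N * beta ^ K * (h * (s ^ a * m)))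
      + x + p)%N ->
  \prod_(b < a) ((s - a - d b)%:R / s%:R) <=
    2 * q%:R / m%:R + K%:R * beta%:R ^+ K * h%:R / a%:R + K.+1%:R / beta%:R :> R.
Proof.
move=> s0 a0 m0 be0 N0 lepN lex.
rewrite -(ler_nat R) => main.
rewrite prodf_div prodr_const card_ord -natr_prod.
move: main; set Pi := (\prod_(b < a) (s - a - d b))%N.
pose D : R := (N * beta ^ k * (a * (s ^ a * m)))%:R.
have sa0 : (0 < s ^ a)%N by rewrite expn_gt0 s0.
have bk0 : (0 < beta ^ k)%N by rewrite expn_gt0 be0.
have D0 : 0 < D by rewrite ltr0n !muln_gt0 N0 bk0 a0 sa0 m0.
have nz n : (0 < n)%N -> n%:R != 0 :> R by move=> n0; rewrite pnatr_eq0 -lt0n.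
have -> : (N * beta ^ k * (a * (Pi * m)))%:R = Pi%:R / s%:R ^+ a * D :> R.
  by rewrite /D !natrM (natrX _ s); field; rewrite expf_neq0 ?nz.
move=> main; rewrite -(ler_pM2r D0); apply: le_trans main _.
rewrite !natrD -addrA !mulrDl -natr1; apply: lerD; first apply: lerD.
- rewrite le_eqVlt; apply/orP; left; apply/eqP.
  by rewrite /D !natrM; field; rewrite nz.
- have -> : K%:R * beta%:R ^+ K * h%:R / a%:R * D =
      (K * (N * beta ^ K * (h * (s ^ a * m))))%:R * (beta ^ k)%:R.
    by rewrite /D !natrM (natrX _ beta K); field; rewrite nz.
  by rewrite ler_peMr // ler1n.
rewrite !mulrDl; apply: lerD.
  rewrite mulrAC ler_pdivlMr ?ltr0n // mulrC -!natrM ler_nat; exact: lex.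
rewrite mul1r mulrC ler_pdivlMr ?ltr0n // -natrM ler_nat.
by apply: leq_trans lepN _; rewrite -mulnA leq_pmulr // !muln_gt0 bk0 a0 sa0 m0.
Qed.

(** Here 1 - u >= exp (- u / (1 - 2 delta)) is used for u <= 2 delta; it follows
    from 1 + v <= exp v for v = u / (1 - 2 delta). *)
Lemma prod_density_ge (R : realType) (s a q : nat) (d : 'I_a -> nat) (delta : R) :
    (0 < s)%N -> 0 <= delta -> delta < 1 / 2 -> a%:R <= delta * s%:R ->
    (forall b, (d b)%:R <= delta * s%:R) -> (\sum_(b < a) d b <= q)%N ->
  expR (- ((a%:R ^+ 2 + q%:R) / (s%:R * (1 - 2 * delta)))) <=
    \prod_(b < a) ((s - a - d b)%:R / s%:R).
Proof.
move=> s0 d0 d2 lea led sumd.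
have sR : 0 < s%:R :> R by rewrite ltr0n.
have D0 : 0 < s%:R * (1 - 2 * delta) by apply: mulr_gt0 => //; lra.
apply: (@le_trans _ _ (expR (\sum_(b < a) - ((a%:R + (d b)%:R) / (s%:R * (1 - 2 * delta)))))).
  rewrite ler_expR sumrN lerN2 -mulr_suml ler_pM2r ?invr_gt0 //.
  rewrite big_split /= sumr_const card_ord expr2 mulr_natr lerD2l -natr_sum ler_nat.
  exact: sumd.
rewrite expR_sum; apply: ler_prod => b _; rewrite expR_ge0 /=.
have le_ads : (a + d b <= s)%N.
  by rewrite -(ler_nat R) natrD; have := led b; nra.
rewrite -subnDA natrB // natrD expRN.
pose u : R := (a%:R + (d b)%:R) / s%:R.
have eu : (a%:R + (d b)%:R) = u * s%:R by rewrite /u mulfVK ?gt_eqF.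
have u0 : 0 <= u by rewrite divr_ge0 // addr_ge0.
have u1 : u <= 2 * delta by rewrite ler_pdivrMr //; have := led b; lra.
have -> : (a%:R + (d b)%:R) / (s%:R * (1 - 2 * delta)) = u / (1 - 2 * delta).
  by rewrite eu invfM mulrA mulfK ?gt_eqF.
have -> : (s%:R - (a%:R + (d b)%:R)) / s%:R = 1 - u.
  by rewrite eu; field; rewrite gt_eqF.
have d1 : 0 < 1 - 2 * delta by lra.
have : 1 + u / (1 - 2 * delta) <= expR (u / (1 - 2 * delta)) by exact: expR_ge1Dx.
have v0 : 0 <= u / (1 - 2 * delta) by rewrite divr_ge0 // ltW.
have vE : u / (1 - 2 * delta) * (1 - 2 * delta) = u by rewrite mulfVK // gt_eqF.
move: (u / _) v0 vE => v v0 vE le1v.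
rewrite -div1r ler_pdivrMr ?expR_gt0 //.
apply: le_trans (_ : (1 - u) * (1 + v) <= _); first by nra.
by rewrite ler_pM2l //; lra.
Qed.

(** The letters stand for l = ln (ln r), X = ln r and E = X ^ (delta / 2). Were the
    layer cheaper, the proportion of missed vertices would be at least
    5/6 * E ^ 2 / X, since (1 - 3 delta) / (1 - 2 delta) <= 1 - delta; while each of
    the three terms bounding it in [layer_density_le] is at most E ^ 2 / (12 X). *)
Lemma layer_cost_ge (R : realType) (K k s a m N beta p g h x Q q : nat)
    (d : 'I_a -> nat) (delta l E X : R) :
    (0 < s)%N -> (0 < a)%N -> (0 < m)%N -> (0 < beta)%N -> (0 < N)%N -> (p * beta <= N)%N ->
    (forall b, d b <= g)%N -> (\sum_(b < a) d b <= Q)%N -> (h * g <= Q)%N ->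
    (beta * x <= K * (N * beta ^ k * (a * (s ^ a * m))))%N ->
    (N * beta ^ k * (a * (\prod_(b < a) (s - a - d b) * m)) <=
      q * (2 * (N * beta ^ k * (a * s ^ a))) + K * (N * beta ^ K * (h * (s ^ a * m)))
      + x + p)%N ->
    0 < delta -> delta <= 1 / 8 -> 1 <= l -> 48 * l / delta <= E ->
    X = expR l -> E = expR (delta * l / 2) ->
    a%:R ^+ 2 <= delta * s%:R -> delta * s%:R / 2 <= g%:R -> g%:R <= delta * s%:R ->
    2 * (s%:R * l) / m%:R <= 4 * l * E / (delta * X) ->
    K.+1%:R / beta%:R <= 4 / (E * X) ->
    K%:R * beta%:R ^+ K / a%:R <= X * expR (- (X / 8)) ->
    48 * l * X ^+ 2 / delta <= expR (X / 8) ->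
  (1 - 3 * delta) * (s%:R * l) <= (Q + q)%:R.
Proof.
move=> s0 a0 m0 be0 N0 lepN leg sumd lehg lex main d0 d8 l1 leE XE EE a2 gge gle mE KbE KaE X8.
rewrite leNgt; apply/negP; rewrite natrD => ltz.
have density := layer_density_le R s0 a0 m0 be0 N0 lepN lex main.
clear main lex lepN N0.
have sR : 0 < s%:R :> R by rewrite ltr0n.
have mR : 0 < m%:R :> R by rewrite ltr0n.
have aR : 0 < a%:R :> R by rewrite ltr0n.
have XR : 0 < X by rewrite XE expR_gt0.
have E384 : 384 <= E.
  apply: le_trans leE; rewrite ler_pdivlMr //; nra.
have a1 : (1 : R) <= a%:R by rewrite ler1n.
have theta := @prod_density_ge R s a Q d delta s0 (ltW d0).
have {}theta : 5 / 6 * (E ^+ 2 / X) <= \prod_(b < a) ((s - a - d b)%:R / s%:R).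
  apply: le_trans (theta _ _ _ sumd); [|lra|nra|].
    rewrite -[X in _ <= X]/(expR _).
    have D0 : 0 < s%:R * (1 - 2 * delta) by apply: mulr_gt0 => //; lra.
    apply: (@le_trans _ _ (expR (- (1 / 6) - (1 - delta) * l))).
      rewrite expRD; apply: ler_pM => //; first by rewrite divr_ge0 ?exprn_ge0 //; lra.
        by have := expR_ge1Dx (- (1 / 6) : R); lra.
      rewrite XE -expRN EE -expRM_natr -expRD le_eqVlt; apply/orP; left; apply/eqP.
      by congr expR; field.
    rewrite ler_expR -opprD lerN2 ler_pdivrMr //.
    have Qlt : Q%:R <= (1 - 3 * delta) * (s%:R * l) by have := ler0n R q; lra.
    have : delta <= 1 / 6 * (1 - 2 * delta) by lra.
    have : 1 - 3 * delta <= (1 - delta) * (1 - 2 * delta) by nra.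
    move=> h1 h2.
    have := ler_wpM2r (ltW (mulr_gt0 sR (lt_le_trans ltr01 l1))) h1.
    have := ler_wpM2r (ltW sR) h2.
    lra.
  by move=> b; apply: le_trans gle; rewrite ler_nat.
have {}density := le_trans theta density.
clear theta leg sumd.
have Qsl : Q%:R <= s%:R * l.
  have := ler0n R q; have : 0 <= s%:R * l by nra.
  by nra.
have qsl : q%:R <= s%:R * l.
  have := ler0n R Q; have : 0 <= s%:R * l by nra.
  by nra.
have EX : 0 < E * X by nra.
have t1 : 2 * q%:R / m%:R <= E ^+ 2 / X / 12.
  apply: (@le_trans _ _ (2 * (s%:R * l) / m%:R)).
    by rewrite ler_pM2r ?invr_gt0 //; nra.
  apply: le_trans mE _.
  have -> : 4 * l * E / (delta * X) = (48 * l / delta) * (E / X / 12).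
    by field; rewrite ?gt_eqF.
  have -> : E ^+ 2 / X / 12 = E * (E / X / 12) by field; rewrite ?gt_eqF.
  by rewrite ler_pM2r //; rewrite !divr_gt0 //; lra.
have t3 : K.+1%:R / beta%:R <= E ^+ 2 / X / 12.
  apply: le_trans KbE _.
  have -> : 4 / (E * X) = 48 * (X^-1 / E / 12) by field; rewrite ?gt_eqF //; lra.
  have -> : E ^+ 2 / X / 12 = E ^+ 3 * (X^-1 / E / 12) by field; rewrite ?gt_eqF //; lra.
  rewrite ler_pM2r; last by rewrite !divr_gt0 ?invr_gt0 //; lra.
  by rewrite !exprS expr0; nra.
have hl : h%:R <= 2 * l / delta.
  rewrite ler_pdivlMr //.
  have : (h%:R * g%:R : R) <= Q%:R by rewrite -natrM ler_nat.
  have h0 := ler0n R h.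
  have := ler_wpM2l h0 gge.
  move=> h1 h2; rewrite -(ler_pM2r sR); lra.
have t2 : K%:R * beta%:R ^+ K * h%:R / a%:R <= E ^+ 2 / X / 12.
  have -> : K%:R * beta%:R ^+ K * h%:R / a%:R = (K%:R * beta%:R ^+ K / a%:R) * h%:R :> R.
    by rewrite mulrAC.
  apply: (@le_trans _ _ (X * expR (- (X / 8)) * (2 * l / delta))).
    by apply: ler_pM => //; rewrite divr_ge0 // mulr_ge0 // exprn_ge0.
  rewrite expRN; set Y := expR (X / 8) in X8 *.
  have Y0 : 0 < Y by exact: expR_gt0.
  have -> : X * Y^-1 * (2 * l / delta) = (48 * l * X ^+ 2 / delta) * (Y^-1 / X / 24).
    by field; rewrite ?gt_eqF.
  apply: (@le_trans _ _ (Y * (Y^-1 / X / 24))).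
    by rewrite ler_pM2r // !divr_gt0 ?invr_gt0 //; lra.
  have -> : Y * (Y^-1 / X / 24) = X^-1 / 24 by field; rewrite ?gt_eqF.
  have -> : E ^+ 2 / X / 12 = 2 * E ^+ 2 * (X^-1 / 24) by field; rewrite ?gt_eqF.
  rewrite ler_peMl //; first by rewrite divr_ge0 // invr_ge0 ltW.
  by rewrite expr2; nra.
have : 0 < E ^+ 2 / X by rewrite divr_gt0 // exprn_gt0 //; lra.
lra.
Qed.

(** * Choice of the parameters *)

(** The exponentials are compared with the powers y ^ 2 and y ^ 5 through
    exp (n y) >= y ^ n; the threshold for l is chosen for convenience. *)
Lemma scale_bounds (R : realType) (delta l : R) :
    0 < delta -> delta <= 1 / 8 -> 10 ^+ 5 / delta ^+ 3 <= l ->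
  [/\ 1 <= l, 48 * l / delta <= expR (delta * l / 2) &
      48 * 2 * l * expR l ^+ 2 / delta <= expR (expR l / 8)].
Proof.
move=> d0 d8; rewrite ler_pdivrMr ?exprn_gt0 // => led.
have d3 : delta ^+ 3 <= 1 by rewrite exprn_ile1 // ?ltW //; lra.
have d2 : delta ^+ 3 <= delta by rewrite exprS ger_pMr // exprn_ile1 // ?ltW //; lra.
have d30 : 0 < delta ^+ 3 by rewrite exprn_gt0.
have l0 : 0 < l.
  by rewrite -(pmulr_lgt0 _ d30); apply: lt_le_trans led; rewrite exprn_gt0.
have ld : 10 ^+ 5 <= l * delta by apply: le_trans led _; rewrite ler_pM2l.
have l1 : 10 ^+ 5 <= l by apply: le_trans led _; rewrite ger_pMr.
have pow10 : (10 ^+ 5 : R) = 10 * 10 * 10 * 10 * 10 by ring.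
rewrite !pow10 in led ld l1.
split; first by lra.
- have -> : delta * l / 2 = delta * l / 4 * 2%:R by field.
  rewrite expRM_natr.
  have dl0 : 0 <= delta * l / 4 by rewrite divr_ge0 // mulr_ge0 // ltW.
  apply: (@le_trans _ _ ((delta * l / 4) ^+ 2)).
    rewrite ler_pdivrMr //.
    have -> : (delta * l / 4) ^+ 2 * delta = (l * delta ^+ 3) * l / 16 by field.
    nra.
  rewrite lerXn2r ?nnegrE ?expR_ge0 //.
  by have := expR_ge1Dx (delta * l / 4); lra.
have lx : l <= expR l by have := expR_ge1Dx l; lra.
move: (expR l) lx => X lX.
have X0 : 0 < X by apply: lt_le_trans lX.
have -> : X / 8 = X / 40 * 5%:R by field.
rewrite expRM_natr; apply: (@le_trans _ _ ((X / 40) ^+ 5)); last first.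
  rewrite lerXn2r ?nnegrE ?expR_ge0 ?divr_ge0 // ?ltW //.
  by have := expR_ge1Dx (X / 40); lra.
have pow40 : (40 ^+ 5 : R) = 40 * 40 * 40 * 40 * 40 by ring.
rewrite ler_pdivrMr // expr_div_n pow40.
have Xd : 10 * 10 * 10 * 10 * 10 <= X * delta by apply: le_trans ld _; rewrite ler_pM2r.
have XX : (10 * 10 * 10 * 10 * 10) * (10 * 10 * 10 * 10 * 10) <= X * (X * delta) by nra.
have -> : X ^+ 5 / (40 * 40 * 40 * 40 * 40) * delta =
    X ^+ 3 * ((X * (X * delta)) / (40 * 40 * 40 * 40 * 40)) by field.
apply: (@le_trans _ _ (96 * X ^+ 3)).
  have -> : 48 * 2 * l * X ^+ 2 = 96 * (l * X ^+ 2) by ring.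
  have -> : X ^+ 3 = X * X ^+ 2 by ring.
  by rewrite ler_pM2l // ler_pM2r // exprn_gt0.
by rewrite mulrC ler_pM2l ?exprn_gt0 //; lra.
Qed.

Lemma trunc_bounds (R : realType) (x : R) : 2 <= x ->
  x / 2 <= (Num.truncn x)%:R /\ (Num.truncn x)%:R <= x.
Proof.
move=> x2; have /truncn_itv/andP[t1 t2] : 0 <= x by lra.
by move: t2; rewrite -natr1; split=> //; lra.
Qed.

Lemma truncS_bounds (R : realType) (x : R) : 1 <= x ->
  x <= (Num.truncn x).+1%:R /\ (Num.truncn x).+1%:R <= 2 * x.
Proof.
move=> x1; have /truncn_itv/andP[t1 t2] : 0 <= x by lra.
by move: t2; rewrite -natr1; split; lra.
Qed.

(** With X = ln r, E = X ^ (delta / 2) and Y = r ^ (1/8), the integers are K = X / E,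
    beta = X ^ 2, m = delta r, s = (1 - delta) r / K, a = Y ^ 2 and g = delta s, up to
    rounding. *)
Lemma layered_parameters (R : realType) (r : nat) (delta l E X Y : R) :
    0 < delta -> delta <= 1 / 8 -> 1 <= l -> 48 * l / delta <= E -> E ^+ 2 <= X ->
    48 * 2 * l * X ^+ 2 / delta <= Y -> r%:R = Y ^+ 8 ->
  exists (K s a m beta g : nat),
    [/\ [/\ (0 < s)%N, (0 < a)%N, (0 < m)%N & (0 < beta)%N],
        (K * s + m <= r)%N,
        [/\ a%:R ^+ 2 <= delta * s%:R, delta * s%:R / 2 <= g%:R & g%:R <= delta * s%:R],
        [/\ 2 * (s%:R * l) / m%:R <= 4 * l * E / (delta * X),
            K.+1%:R / beta%:R <= 4 / (E * X), K%:R <= 2 * (X / E),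
            beta%:R <= X ^+ 3 & Y ^+ 2 / 2 <= a%:R] &
        (1 - 2 * delta) * r%:R <= K%:R * s%:R].
Proof.
move=> d0 d8 l1 El EX XY rY.
have E384 : 384 <= E.
  by apply: le_trans El; rewrite ler_pdivlMr //; nra.
have E0 : 0 < E by lra.
have EEX : E * E <= X by rewrite -expr2.
have XEE : E <= X / E by rewrite ler_pdivlMr.
have X384 : 384 <= X by nra.
have X0 : 0 < X by lra.
have dY : X ^+ 2 <= delta * Y.
  move: XY; rewrite ler_pdivrMr // => XY; rewrite mulrC; apply: le_trans XY.
  by rewrite ler_peMl ?exprn_ge0 //; lra.
clear El EX XY.
have l0 : 0 < l by lra.
have XE0 : 0 < X / E by exact: divr_gt0.
have XleX2 : 384 * X <= X ^+ 2 by rewrite expr2 ler_pM2r.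
have Y1 : 384 <= Y by nra.
have Y0 : 0 < Y by lra.
have Yn n : 384 <= Y ^+ n.+1.
  by apply: (le_trans Y1); rewrite exprS ler_peMr ?exprn_ege1 //; lra.
have dr : 384 * X <= delta * r%:R.
  rewrite rY exprS mulrA; apply: le_trans XleX2 _; apply: (le_trans dY).
  have := Yn 6%N; move: (Y ^+ 7) => Z Z1.
  by rewrite ler_peMr ?mulr_ge0 ?ltW //; lra.
have [K [K1 K2]] : exists K : nat, X / E <= K%:R /\ K%:R <= 2 * (X / E).
  by eexists; apply: truncS_bounds; lra.
have [beta [b1 b2]] : exists b : nat, X ^+ 2 <= b%:R /\ b%:R <= 2 * X ^+ 2.
  by eexists; apply: truncS_bounds; lra.
have [m [m1 m2]] : exists m : nat, delta * r%:R / 2 <= m%:R /\ m%:R <= delta * r%:R.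
  by eexists; apply: trunc_bounds; lra.
have [a [a1 a2]] : exists a : nat, Y ^+ 2 / 2 <= a%:R /\ a%:R <= Y ^+ 2.
  by eexists; apply: trunc_bounds; have := Yn 1%N; lra.
have K0 : 0 < K%:R :> R by lra.
have KX : 4 * K%:R <= X.
  have : X / E * E = X by rewrite mulfVK // gt_eqF.
  have : 384 * (X / E) <= E * (X / E) by rewrite ler_pM2r //; lra.
  by lra.
have rdr : 8 * (delta * r%:R) <= r%:R.
  by rewrite mulrA ler_piMl //; lra.
pose S := (1 - delta) * r%:R / K%:R.
have SK : S * K%:R = (1 - delta) * r%:R by rewrite /S mulfVK // gt_eqF.
have S0 : 0 <= S by rewrite divr_ge0 ?mulr_ge0 //; lra.
clearbody S.
have XS : r%:R <= S / 2 * X.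
  have : S * (4 * K%:R) <= S * X by rewrite ler_wpM2l //; lra.
  by rewrite mulrCA SK; lra.
have dSY : Y ^+ 7 * X <= delta * (S / 2).
  rewrite -(ler_pM2r X0) -[leRHS]mulrA.
  apply: (@le_trans _ _ (delta * r%:R)); last by rewrite ler_pM2l.
  have -> : delta * r%:R = delta * Y * Y ^+ 7 by rewrite rY exprS mulrA.
  have -> : Y ^+ 7 * X * X = X ^+ 2 * Y ^+ 7 by ring.
  by rewrite ler_pM2r ?exprn_gt0.
have dSY4 : Y ^+ 4 <= delta * (S / 2).
  apply: le_trans dSY; have -> : Y ^+ 7 = Y ^+ 4 * Y ^+ 3 by rewrite -exprD.
  have YX : 1 <= Y ^+ 3 * X by rewrite mulr_ege1 //; [have := Yn 2%N; lra|lra].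
  by rewrite -mulrA ler_peMr // exprn_ge0 // ltW.
clear XS dSY.
have S2 : 2 <= S.
  have := Yn 3%N; have : delta * (S / 2) <= 1 * (S / 2) by rewrite ler_wpM2r //; lra.
  by lra.
have [s [s1 s2 s3]] : exists s : nat, [/\ S / 2 <= s%:R, S - 1 <= s%:R & s%:R <= S].
  exists (Num.truncn S); have [? ?] := trunc_bounds S2; split=> //.
  have /truncn_itv/andP[_ ] : 0 <= S by lra.
  by rewrite -natr1; lra.
have dsS : delta * (S / 2) <= delta * s%:R by rewrite ler_pM2l.
have [g [g1 g2]] : exists g : nat, delta * s%:R / 2 <= g%:R /\ g%:R <= delta * s%:R.
  by eexists; apply: trunc_bounds; have := Yn 3%N; lra.
have sK2 : K%:R * s%:R <= (1 - delta) * r%:R by rewrite -SK mulrC ler_pM2r.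
have m0 : 0 < m%:R :> R by lra.
have be0 : 0 < beta%:R :> R by lra.
exists K, s, a, m, beta, g; split.
- have s0 : 0 < s%:R :> R by lra.
  have a0 : 0 < a%:R :> R by have := Yn 1%N; lra.
  by rewrite -!(ltr0n R).
- by rewrite -(ler_nat R) natrD natrM; lra.
- split=> //; apply: le_trans dsS; apply: le_trans dSY4.
  have -> : Y ^+ 4 = (Y ^+ 2) ^+ 2 by rewrite -exprM.
  by apply: lerXn2r => //; rewrite nnegrE ?exprn_ge0 // ltW.
- split=> //.
  + rewrite ler_pdivrMr //.
    apply: (@le_trans _ _ (4 * l * E / (delta * X) * (delta * r%:R / 2))); last first.
      by rewrite ler_pM2l // divr_gt0 ?mulr_gt0.
    have -> : 4 * l * E / (delta * X) * (delta * r%:R / 2) = 2 * (r%:R / (X / E) * l).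
      by field; rewrite !gt_eqF.
    rewrite ler_pM2l // ler_pM2r // ler_pdivlMr //.
    apply: (@le_trans _ _ (s%:R * K%:R)); first by rewrite ler_wpM2l.
    by rewrite mulrC; lra.
  + rewrite -natr1 ler_pdivrMr //.
    apply: (@le_trans _ _ (4 / (E * X) * X ^+ 2)); last first.
      by rewrite ler_pM2l // divr_gt0 ?mulr_gt0.
    have -> : 4 / (E * X) * X ^+ 2 = 4 * (X / E) by field; rewrite !gt_eqF.
    by lra.
  + by apply: (le_trans b2); rewrite [X in _ <= X]exprS ler_pM2r ?exprn_gt0 //; lra.
- have : (S - 1) * K%:R <= s%:R * K%:R by rewrite ler_pM2r.
  by rewrite mulrBl SK [s%:R * _]mulrC; lra.
Qed.

Local Open Scope classical_set_scope.
Local Open Scope ring_scope.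

(** * The lower bound *)

Lemma paths_lower_bound (R : realType) (r p : nat) (delta l : R) :
    0 < delta -> delta <= 1 / 8 -> 10 ^+ 5 / delta ^+ 3 <= l ->
    r%:R = expR (expR l) -> paths_suffice r p ->
  (1 - 5 * delta) * (r%:R * l) <= p%:R.
Proof.
move=> d0 d8 led rE suff_p.
have [l1 El XY] := scale_bounds d0 d8 led; clear led.
have EX : expR (delta * l / 2) ^+ 2 <= expR l.
  rewrite -expRM_natr ler_expR mulfVK // ?pnatr_eq0 // ger_pMl; lra.
have rY : r%:R = expR (expR l / 8) ^+ 8 :> R.
  by rewrite rE -expRM_natr mulfVK // pnatr_eq0.
have [K [s [a [m [beta [g [[s0 a0 m0 be0] ler [a2 g1 g2] [c1 c2 K2 b3 a1] Ks]]]]]]] :=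
  layered_parameters d0 d8 l1 El EX XY rY.
have [Q [q [sumQ layer]]] :=
  @layered_inequality K s a m (p * beta).+1 beta be0 r p g m0 ler suff_p.
have E0 : 0 < expR (delta * l / 2) by exact: expR_gt0.
have X0 : 0 < expR l by exact: expR_gt0.
(* beta ^ K <= X ^ (3 K) <= exp (6 l X / E) <= r ^ (1/8), well below a ~ r ^ (1/4). *)
have c3 : K%:R * beta%:R ^+ K / a%:R <= expR l * expR (- (expR l / 8)).
  have l0 : 0 < l by lra.
  have E48 : 48 * l <= expR (delta * l / 2).
    by apply: le_trans El; rewrite ler_pdivlMr // ger_pMr; lra.
  have E4 : 4 <= expR (delta * l / 2) by lra.
  have bK : beta%:R ^+ K <= expR (expR l / 8).
    apply: (@le_trans _ _ (expR (3%:R * l) ^+ K)).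
      by apply: lerXn2r; rewrite ?nnegrE ?expR_ge0 // expRM_natl.
    rewrite -expRM_natr ler_expR.
    apply: (@le_trans _ _ (3%:R * l * (2 * (expR l / expR (delta * l / 2))))).
      by rewrite ler_pM2l // mulr_gt0.
    move: (expR (delta * l / 2)) (expR l) E0 X0 E48 => E X E0 X0 E48.
    have -> : 3%:R * l * (2 * (X / E)) = 48 * l * (X / E / 8) by field; rewrite gt_eqF.
    have -> : X / 8 = E * (X / E / 8) by field; rewrite gt_eqF.
    by rewrite ler_pM2r // !divr_gt0.
  have aR : 0 < a%:R :> R by rewrite ltr0n.
  rewrite ler_pdivrMr // expRN.
  have Y0 : 0 < expR (expR l / 8) by exact: expR_gt0.
  move: (expR (expR l / 8)) Y0 bK a1 => Y Y0 bK a1.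
  move: (expR (delta * l / 2)) (expR l) E0 X0 K2 E4 => E X E0 X0 K2 E4.
  apply: (@le_trans _ _ (2 * (X / E) * Y)).
    by apply: ler_pM => //; rewrite exprn_ge0.
  apply: (@le_trans _ _ (X * Y^-1 * (Y ^+ 2 / 2))); last first.
    by rewrite ler_pM2l // mulr_gt0 // invr_gt0.
  have -> : X * Y^-1 * (Y ^+ 2 / 2) = E * (X / E / 2) * Y by field; rewrite !gt_eqF.
  rewrite ler_pM2r // (_ : 2 * (X / E) = 4 * (X / E / 2)); last by field; rewrite gt_eqF.
  by rewrite ler_pM2r // !divr_gt0.
have cost k : (1 - 3 * delta) * (s%:R * l) <= (Q k + q k)%:R.
  have [d [h [x [leg sumd lehg lex main]]]] := layer k.
  apply: (layer_cost_ge s0 a0 m0 be0 (ltn0Sn _) (leqnSn _) leg sumd lehg lex main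
    d0 d8 l1 El) => //.
  apply: le_trans XY; rewrite ler_pM2r ?invr_gt0 // ler_pM2r ?exprn_gt0 //.
  by rewrite ler_pM2r; lra.
have sumc : K%:R * ((1 - 3 * delta) * (s%:R * l)) <= p%:R.
  apply: le_trans (_ : (\sum_(k < K) (Q k + q k))%:R <= _); last by rewrite ler_nat.
  rewrite natr_sum -[K in K%:R * _]card_ord mulr_natl -sumr_const.
  by apply: ler_sum => k _; exact: cost.
apply: le_trans sumc.
have -> : K%:R * ((1 - 3 * delta) * (s%:R * l)) = (1 - 3 * delta) * (K%:R * s%:R) * l by ring.
have l0 : 0 < l by lra.
have r0 : 0 <= r%:R :> R by [].
rewrite [leLHS]mulrA ler_pM2r //.
apply: (@le_trans _ _ ((1 - 3 * delta) * ((1 - 2 * delta) * r%:R))).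
  by rewrite mulrA ler_wpM2r //; nra.
by rewrite ler_pM2l //; lra.
Qed.

Theorem theorem1p2 (R : realType) :
  exists2 f : nat -> R,
    f r @[r --> \oo] --> (0 : R) &
    \forall r \near \oo,
      (((1 - f r) * (r%:R * ln (ln r%:R)))%:E <= p_path R r)%E.
Proof.
(* The error f is defined from p_path itself; capping p_path at x r keeps f r in
   [0, 1] and covers the value +oo. *)
pose x r : R := r%:R * ln (ln r%:R).
pose g r : R := fine (mine (p_path R r) (x r)%:E).
have path_ge0 r : (0 <= p_path R r)%E.
  by apply: le_ereal_inf_tmp => _ [q _ <-]; rewrite lee_fin.
have x_large (M : R) : \forall r \near \oo, M <= ln (ln (r%:R : R)) /\
    r%:R = expR (expR (ln (ln (r%:R : R)))).
  near=> r.
  have r1 : expR (expR M) <= r%:R by near: r; exact: nbhs_infty_ger.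
  have r0 : 0 < r%:R :> R by apply: lt_le_trans r1; exact: expR_gt0.
  have lnr : expR M <= ln (r%:R : R) by rewrite -ler_expR lnK.
  have lnr0 : 0 < ln (r%:R : R) by apply: lt_le_trans lnr; exact: expR_gt0.
  by split; [rewrite -ler_expR lnK | rewrite !lnK].
have gE r : 0 < x r -> [/\ 0 <= g r, g r <= x r & ((g r)%:E <= p_path R r)%E].
  move=> x0; have m0 : (0 <= mine (p_path R r) (x r)%:E)%E.
    by rewrite le_min path_ge0 lee_fin ltW.
  have mx : (mine (p_path R r) (x r)%:E <= (x r)%:E)%E by rewrite ge_min lexx orbT.
  have mfin : mine (p_path R r) (x r)%:E \is a fin_num.
    by rewrite ge0_fin_numE // (le_lt_trans mx) ?ltry.
  by rewrite -lee_fin -[in g r <= _]lee_fin /g !fineK // m0 mx ge_min lexx.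
exists (fun r => 1 - g r / x r); last first.
  near=> r.
  have [l1 rE] : 1 <= ln (ln (r%:R : R)) /\ r%:R = expR (expR (ln (ln (r%:R : R)))).
    by near: r; exact: x_large.
  have x0 : 0 < x r by rewrite /x {1}rE mulr_gt0 ?expR_gt0 // (lt_le_trans _ l1).
  by rewrite subKr mulfVK ?gt_eqF //; case: (gE r x0).
apply/cvgrPdist_le => e e0; near=> r.
pose delta := Num.min (e / 5) (1 / 8).
have d0 : 0 < delta by rewrite lt_min !divr_gt0.
have d8 : delta <= 1 / 8 by rewrite ge_min lexx orbT.
have de : 5 * delta <= e by rewrite mulrC -ler_pdivlMr // ge_min lexx.
have [lM rE] : 1 + 10 ^+ 5 / delta ^+ 3 <= ln (ln (r%:R : R)) /\
    r%:R = expR (expR (ln (ln (r%:R : R)))).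
  by near: r; exact: x_large.
have M0 : 0 <= 10 ^+ 5 / delta ^+ 3 by rewrite divr_ge0 ?exprn_ge0 // ltW.
have lM' : 10 ^+ 5 / delta ^+ 3 <= ln (ln (r%:R : R)) by apply: le_trans lM; rewrite lerDr.
have x0 : 0 < x r.
  rewrite /x {1}rE mulr_gt0 ?expR_gt0 // (lt_le_trans _ lM) //.
  by rewrite ltr_pwDl.
have [g0 gx _] := gE r x0.
have glow : (1 - 5 * delta) * x r <= g r.
  rewrite -lee_fin /g fineK; last first.
    rewrite ge0_fin_numE ?le_min ?path_ge0 ?lee_fin ?ltW //.
    by rewrite (@le_lt_trans _ _ (x r)%:E) ?ltry // ge_min lexx orbT.
  rewrite le_min lee_fin; apply/andP; split; last by rewrite ler_piMl ?ltW //; lra.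
  apply: le_ereal_inf_tmp => _ [q sq <-]; rewrite lee_fin.
  exact: (paths_lower_bound d0 d8 lM' rE sq).
have gx1 : g r / x r <= 1 by rewrite ler_pdivrMr // mul1r.
have gx2 : 1 - 5 * delta <= g r / x r by rewrite ler_pdivlMr.
rewrite sub0r normrN ger0_norm; lra.
Unshelve. all: by end_near.
Qed.
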